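(* Fix an integer $d\geq 3$. Let $G=G_n$ be (a member of an infinite sequence of) $d$-regular graphs on $n$ vertices, $n\to\infty$, in which each vertex is contained in a cycle of length $g=g(n)$. If $k=k(n)$ satisfies $$k=\frac{\log_{d-1}(n/\log n)-\omega(1)}{g},$$ i.e. $\log_{d-1}(n/\log n)-k(n)g(n)\to\infty$ as $n\to\infty$, then, with high probability, a non-backtracking random walk of length $n$ on $G$ (from any given starting vertex) visits some vertex at least $k$ times. In particular, such a walk almost surely visits some vertex $\Omega\left(\frac{\log n}{g}\right)$ times; that is, there is a constant $c>0$ (which may depend on $d$) such that with probability tending to $1$ as $n\to\infty$ some vertex is visited at least $c\frac{\log n}{g(n)}$ times.
   Context: Graphs are finite, undirected and simple. Logarithms without a specified base are natural. The notation $\omega(1)$ stands for a function of $n$ tending to infinity with $n$. A non-backtracking random walk of length $m$ on $G=(V,E)$ from a vertex $w_0$ is a uniformly chosen member of the set of sequences $(w_0,w_1,\dots,w_m)$ of vertices with $w_{t-1}w_t\in E$ for all $1\leq t\leq m$ and $w_{t-1}\neq w_{t+1}$ for all $1\leq t\leq m-1$. The number of times it visits a vertex $v$ is the number of indices $t\in\{0,\dots,m\}$ with $w_t=v$. An event defined for an infinite series of graphs occurs with high probability (almost surely) if its probability tends to $1$ as the number of vertices tends to infinity. *)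

(* Defs.v *)
From HB Require Import structures.
From mathcomp Require Import all_boot all_order all_algebra.
From mathcomp Require Import all_classical all_reals all_analysis.
Set Implicit Arguments.
Unset Strict Implicit.
Unset Printing Implicit Defensive.
Import Order.TTheory GRing.Theory Num.Theory.
Import numFieldNormedType.Exports.
Local Open Scope ring_scope.

Record sgraph := SGraph {
  vertex :> finType;
  adj : rel vertex;
  adj_sym : symmetric adj;
  adj_irr : irreflexive adj }.

Definition regular (d : nat) (G : sgraph) : Prop :=
  forall v : G, #|adj v| = d.

(* The condition 2 < g is needed: ucycle holds of the sequence [:: u; v]
   whenever u and v are adjacent. *)
Definition on_cycle (G : sgraph) (g : nat) (v : G) : Prop :=
  exists c : seq G,
    [/\ (2 < g)%N, size c = g, ucycle (@adj G) c & v \in c].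

Definition nbwalks (G : sgraph) (m : nat) (w0 : G) :
    {set {ffun 'I_m.+1 -> G}} :=
  [set w : {ffun 'I_m.+1 -> G} | [&& w ord0 == w0,
    [forall s : 'I_m.+1, forall t : 'I_m.+1, (t == s.+1 :> nat) ==>
      adj (w s) (w t)] &
    [forall s : 'I_m.+1, forall t : 'I_m.+1, (t == s.+2 :> nat) ==>
      (w s != w t)]]].

Definition visits (G : sgraph) (m : nat) (w : {ffun 'I_m.+1 -> G}) (v : G) :
    nat :=
  #|[set t | w t == v]%SET|.

(* Probability of the event E for the uniform distribution on nbwalks m w0. *)
Definition nbw_prob (R : realType) (G : sgraph) (m : nat) (w0 : G)
    (E : pred {ffun 'I_m.+1 -> G}) : R :=
  #|[set w in nbwalks m w0 | E w]|%:R / #|nbwalks m w0|%:R.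

(* The threshold x is real, so it need not be rounded. *)
Definition heavily_visited (R : realType) (G : sgraph) (m : nat) (x : R) :
    pred {ffun 'I_m.+1 -> G} :=
  fun w => [exists v : G, x <= (visits w v)%:R].

Definition logb (R : realType) (b x : R) : R := ln x / ln b.

(* Graph sequences are indexed by an arbitrary i : nat, with #|G i| vertices
   (d-regular graphs on n vertices need not exist for every n); functions of n
   become functions of i. *)
Definition regular_seq_with_cycles (d : nat) (G : nat -> sgraph)
    (g : nat -> nat) : Prop :=
  [/\ (#|G i| @[i --> \oo] --> \oo)%classic,
      forall i, regular d (G i) &
      forall i (v : G i), on_cycle (g i) v].

(* Main.v *)
Require Import Defs.
From HB Require Import structures.
From mathcomp Require Import all_boot all_order all_algebra.
From mathcomp Require Import all_classical all_reals all_analysis.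
From mathcomp Require Import zify lra.
Set Implicit Arguments.
Unset Strict Implicit.
Unset Printing Implicit Defensive.
Import Order.TTheory GRing.Theory Num.Theory.
Import numFieldNormedType.Exports.
Local Open Scope classical_set_scope.
Local Open Scope ring_scope.

(** Let b = d - 1 and let n be the number of vertices. If k <= 1, the starting
    vertex is visited often enough. Otherwise let K be the natural number with
    K < k <= K + 1. Cut the walk into blocks of L = K g steps. Suppose that a
    block begins at v and that the step before it came from u.
    A cycle of length g through v leaves v in two directions, and at least one
    of these avoids u. Going K times around the cycle in that direction is a
    legal non-backtracking continuation ([exists_loops]), and it visits v once
    at its start and once per turn, hence K + 1 >= k times. Every continuation
    of the block has probability b^-L, so each block succeeds with probability
    at least b^-L, whatever happened before it. All of the q = (n - 1) / L
    blocks fail with probability at most (1 - b^-L)^q ([nbw_prob_blocks]).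

    Let X be the gap log_b (n / ln n) - k g. Since L <= k g, the success
    probability b^-L is at least b^X ln n / n. Moreover, once X >= 0 and
    ln n >= 1, L ln b <= ln n, so q is at least of order n / ln n. Hence q b^-L
    is at least b^X up to a constant factor, and the failure probability is
    exponentially small in X ([nbw_prob_lower]). This gives the first part of
    the theorem. The second part is the special case k g = ln n / (2 ln b), for
    which the gap (ln n / 2 - ln ln n) / ln b tends to infinity
    ([cvgy_half_log_gap]).

    Probabilities are handled by counting. The number of continuations of a
    given length after a directed edge (u, v) satisfies a recursion on the
    length ([nbcountS]), and the block argument becomes an induction on the
    number of blocks ([nbcount_light]). *)

(** * Non-backtracking continuations of a directed edge *)

Section Continuations.
Local Open Scope nat_scope.

(** Here u is the vertex visited just before v. Taking u = v imposes no
    constraint on the first step, because adj is irreflexive; a whole walk from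
    w0 is thus the case u = v = w0. *)
Fixpoint nbpath (G : sgraph) (u v : G) (s : seq G) : bool :=
  if s is x :: s' then [&& adj v x, x != u & nbpath v x s'] else true.

(** The directed edge along which [v :: s] arrives at its end is
    (last u (belast v s), last v s), also when s is empty. *)
Lemma nbpath_cat (G : sgraph) (u v : G) (s1 s2 : seq G) :
  nbpath u v (s1 ++ s2) =
  nbpath u v s1 && nbpath (last u (belast v s1)) (last v s1) s2.
Proof.
elim: s1 u v => [|x s1 IH] u v //=.
by rewrite IH !andbA.
Qed.

Lemma nbpathP (G : sgraph) (u v x0 : G) (s : seq G) :
  reflect (forall i, i < size s ->
             adj (nth x0 (v :: s) i) (nth x0 s i)
             /\ nth x0 s i != nth x0 (u :: v :: s) i)
          (nbpath u v s).
Proof.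
elim: s u v => [|x s IH] u v /=; first exact: ReflectT.
apply: (iffP and3P) => [[avx xu /IH h] [|i] //= | h].
  by rewrite ltnS; apply: h.
have [avx xu] := h 0 isT; split=> //; apply/IH => i lti.
exact: (h i.+1).
Qed.

Definition nbcount (G : sgraph) (m : nat) (u v : G) (P : pred (seq G)) : nat :=
  #|[set t : m.-tuple G | nbpath u v t && P t]%SET|.

(** Sorts the continuations by their first step. *)
Lemma nbcountS (G : sgraph) (m : nat) (u v : G) (P : pred (seq G)) :
  nbcount m.+1 u v P =
  \sum_(x | adj v x && (x != u)) nbcount m v x (fun s => P (x :: s)).
Proof.
rewrite /nbcount -sum1_card.
rewrite (partition_big (fun t : m.+1.-tuple G => thead t)
  (fun x => adj v x && (x != u))) /=; last first.
  move=> t; case/tupleP: t => x t; rewrite inE theadE /=.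
  by case/andP=> /and3P[-> ->].
apply: eq_bigr => x /andP[avx xu].
rewrite sum1_card.
rewrite -(card_imset (f := fun t : m.-tuple G => [tuple of x :: t]));
  last first.
  by move=> s t /(congr1 val) [] /val_inj.
apply: eq_card => t; rewrite [LHS]unfold_in; apply/andP/imsetP.
  case/tupleP: t => y t; rewrite theadE => -[] /[swap] /eqP ->.
  by rewrite inE /= avx xu => h; exists t => //; rewrite inE.
by case=> s; rewrite inE => h ->; rewrite inE theadE /= avx xu.
Qed.

Lemma nbcount0 (G : sgraph) (u v : G) (P : pred (seq G)) :
  nbcount 0 u v P = P [::].
Proof.
rewrite /nbcount; case: (boolP (P [::])) => h /=.
  by apply/eqP/cards1P; exists [tuple]; apply/setP => t;
    rewrite !inE tuple0 /= h.
by apply/eqP; rewrite cards_eq0; apply/eqP/setP => t;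
  rewrite !inE tuple0 /= (negbTE h).
Qed.

Lemma leq_nbcount (G : sgraph) (m : nat) (u v : G) (P Q : pred (seq G)) :
  (forall s, P s -> Q s) -> nbcount m u v P <= nbcount m u v Q.
Proof.
move=> PQ; apply/subset_leq_card/fintype.subsetP => t; rewrite !inE.
by case/andP=> -> /PQ.
Qed.

Lemma card_nbsteps (G : sgraph) (b : nat) (u v : G) :
  regular b.+1 G -> adj u v -> #|[pred x | adj v x && (x != u)]| = b.
Proof.
move=> regG auv; have := regG v.
have uv : u \in adj v by rewrite -[_ \in _]/(adj v u) adj_sym.
rewrite (cardD1 u) uv add1n => -[<-].
by apply: eq_card => x; rewrite !inE andbC.
Qed.

Lemma nbcount_total (G : sgraph) (b m : nat) (u v : G) :
  regular b.+1 G -> adj u v -> nbcount m u v xpredT = b ^ m.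
Proof.
move=> regG; elim: m u v => [|m IH] u v auv; first by rewrite nbcount0.
rewrite nbcountS (eq_bigr (fun=> b ^ m)) => [|x /andP[avx _]]; last exact: IH.
by rewrite sum_nat_const (card_nbsteps regG auv) expnS.
Qed.

(** Each of the at most b ^ L prefixes of length L has at most A completions. *)
Lemma nbcount_prefix (G : sgraph) (b L m A : nat) (u v : G) (P : pred (seq G)) :
  regular b.+1 G -> adj u v ->
  (forall s, size s = L -> nbpath u v s ->
     nbcount m (last u (belast v s)) (last v s) (fun s' => P (s ++ s')) <= A) ->
  nbcount (L + m) u v P <= b ^ L * A.
Proof.
move=> regG; elim: L u v P => [|L IH] u v P auv hA.
  by rewrite mul1n; apply: (hA [::]).
rewrite addSn nbcountS expnS -mulnA -{1}(card_nbsteps regG auv) -sum_nat_const.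
apply: leq_sum => x /andP[avx xu]; apply: IH => // s szs nbs.
by apply: (hA (x :: s)) => /=; rewrite ?szs ?avx ?xu.
Qed.

(** One particular prefix s0 has no completion at all, which leaves at most
    b ^ size s0 - 1 prefixes. The induction follows s0: at each step one branch
    continues along s0 and each of the other b - 1 branches is bounded by
    [nbcount_prefix]. *)
Lemma nbcount_prefix_avoid (G : sgraph) (b m A : nat) (u v : G) (s0 : seq G)
    (P : pred (seq G)) :
  regular b.+1 G -> adj u v -> nbpath u v s0 ->
  (forall s', ~~ P (s0 ++ s')) ->
  (forall s, size s = size s0 -> nbpath u v s ->
     nbcount m (last u (belast v s)) (last v s) (fun s' => P (s ++ s')) <= A) ->
  nbcount (size s0 + m) u v P <= (b ^ size s0 - 1) * A.
Proof.
move=> regG; elim: s0 u v P => [|y s0 IH] u v P auv /= nbs0 notP hA.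
  rewrite subnn mul0n leqn0 cards_eq0; apply/eqP/setP => t.
  by rewrite !inE (negbTE (notP t)) andbF.
case/and3P: nbs0 => avy yu nbs0.
have b0 : 0 < b.
  rewrite -(card_nbsteps regG auv); apply/card_gt0P; exists y.
  by rewrite inE avy.
have splitb : (b ^ (size s0).+1 - 1) * A =
    (b ^ size s0 - 1) * A + b.-1 * (b ^ size s0 * A).
  rewrite mulnA -mulnDl; congr (_ * _); rewrite expnS.
  have : 0 < b ^ size s0 by rewrite expn_gt0 b0.
  by case: (b) b0 => // b' _; rewrite /= mulSn; lia.
rewrite addSn nbcountS (bigD1 y) ?avy //= splitb; apply: leq_add.
  apply: (IH _ _ _ avy nbs0) => [s'|s szs nbs]; first exact: (notP s').
  by apply: (hA (y :: s)); rewrite /= ?szs ?avy ?yu.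
have -> : b.-1 = #|[pred x | adj v x && (x != u) & x != y]|.
  move: (card_nbsteps regG auv); rewrite (cardD1 y) inE avy yu /= add1n => <-.
  by apply: eq_card => x; rewrite !inE andbC.
rewrite -sum_nat_const; apply: leq_sum => x /andP[/andP[avx xu] _].
apply: (nbcount_prefix regG) => // s szs nbs.
by apply: (hA (x :: s)); rewrite /= ?szs ?avx ?xu.
Qed.

Lemma uniq_nbpath (G : sgraph) (u v : G) (s : seq G) :
  uniq (u :: v :: s) -> path (@adj G) v s -> nbpath u v s.
Proof.
elim: s u v => [|x s IH] u v //= /andP[us /andP[vs uqs]] /andP[avx ps].
rewrite avx IH //=; last by rewrite vs.
by move: us; rewrite !inE !negb_or (eq_sym x) => /and3P[_ -> _].
Qed.

(** A closed tour of a cycle backtracks neither inside, where its vertices are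
    distinct, nor at its last step, since the cycle has at least three
    vertices. *)
Lemma nbpath_loop (G : sgraph) (u v x : G) (p : seq G) :
  p != [::] -> uniq [:: v, x & p] -> path (@adj G) v (rcons (x :: p) v) ->
  x != u -> nbpath u v (rcons (x :: p) v).
Proof.
case/lastP: p => // p z _ uqp pth xu.
move: pth; rewrite rcons_path => /andP[/= /andP[avx pth] azv].
rewrite avx xu -cats1 nbpath_cat uniq_nbpath //=.
rewrite belast_rcons !last_rcons /= andbT.
move: azv; rewrite last_rcons => -> /=.
have : last x p \in x :: p by rewrite mem_last.
case/andP: uqp; rewrite -rcons_cons mem_rcons inE negb_or => /andP[_ nv] _.
by apply: contraTneq => <-.
Qed.

(** Between two tours the walk arrives from the last vertex of the cycle and
    leaves to the first one, and these are distinct. *)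
Lemma nbpath_loops (G : sgraph) (u v x : G) (p : seq G) (K : nat) :
  p != [::] -> uniq [:: v, x & p] -> path (@adj G) v (rcons (x :: p) v) ->
  x != u -> nbpath u v (flatten (nseq K (rcons (x :: p) v))).
Proof.
move=> p0 uqp pth; elim: K u => [|K IH] u xu //.
rewrite -[flatten _]/(rcons (x :: p) v ++ flatten (nseq K (rcons (x :: p) v))).
rewrite nbpath_cat nbpath_loop // last_rcons belast_rcons.
apply: IH => /=; case/lastP: p p0 uqp {pth} => // p z _ /= /andP[_ /andP[]].
by rewrite last_rcons mem_rcons inE negb_or => /andP[].
Qed.

(** The successor x and the predecessor of v on the cycle are distinct, so one
    of them differs from u: the cycle is followed forwards if x differs from u,
    and backwards if x = u. *)
Lemma exists_loops (G : sgraph) (g K : nat) (u v : G) :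
  on_cycle g v ->
  exists s, [/\ size s = K * g, nbpath u v s & K <= count_mem v s].
Proof.
case=> c [g2 szc ucc vc].
have /andP[cyc uqc] := ucc.
case/rot_to: vc => i [|x [|y p]] rotc;
  try by move: szc g2; rewrite -(size_rot i) rotc => <-.
have {cyc} cyc : cycle (@adj G) [:: v, x, y & p].
  by move: cyc; rewrite -(rot_cycle i) rotc.
have {uqc} uqc : uniq [:: v, x, y & p] by rewrite -rotc rot_uniq.
have {rotc} szc' : size [:: x, y & p] = g.-1.
  by rewrite -szc -(size_rot i c) rotc.
have sz q : size q = g.-1 -> size (flatten (nseq K (rcons q v))) = K * g.
  move=> szq; rewrite size_flatten /shape map_nseq sumn_nseq size_rcons szq.
  by rewrite prednK 1?mulnC //; case: (g) g2.
have cnt q : K <= count_mem v (flatten (nseq K (rcons q v))).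
  rewrite count_flatten map_nseq sumn_nseq -cats1 count_cat /= eqxx.
  by rewrite addnA addn0 addn1 mulSn leq_addr.
case: (eqVneq x u) => [xu | xu]; last first.
  exists (flatten (nseq K (rcons [:: x, y & p] v))).
  split; [exact: sz | | exact: cnt].
  exact: nbpath_loops.
(* For x = u the cycle is traversed backwards: rev [:: x, y & p] = z :: q. *)
have [q [z rq]] : exists q z, rev [:: x, y & p] = z :: q.
  by case: (rev _) (size_rev [:: x, y & p]) => // z q _; exists q, z.
have szq : size (z :: q) = g.-1 by rewrite -rq size_rev.
exists (flatten (nseq K (rcons (z :: q) v))); split; [exact: sz | | exact: cnt].
apply: nbpath_loops.
- by case: q {rq} szq szc' => // <-.
- rewrite -rq cons_uniq mem_rev rev_uniq; exact: uqc.
- rewrite -rq -rev_cons.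
  have := rev_path (@adj G) v (rcons [:: x, y & p] v).
  rewrite last_rcons belast_rcons => ->.
  by rewrite (eq_path (e' := @adj G)) // => a b; rewrite /= adj_sym.
- have <- : last x (y :: p) = z.
    rewrite -[last _ _]/(last x [:: x, y & p]) -[X in last _ X]revK rq.
    by rewrite rev_cons last_rcons.
  rewrite -xu; case/and3P: uqc => _ xyp _.
  by apply: contraNneq xyp => <-; exact: (mem_last y p).
Qed.

Definition light (T : finType) (K : nat) (s : seq T) : bool :=
  [forall v, count_mem v s <= K].

(** The block argument: in each block of K * g steps the continuation from
    [exists_loops] is excluded, since together with the starting vertex it
    gives K + 1 visits. The starting vertex of a block is counted in that
    block, which is why the list is [v :: s]. *)
Lemma nbcount_light (G : sgraph) (b g K q r : nat) (u v : G) :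
  regular b.+1 G -> (forall x : G, on_cycle g x) -> adj u v ->
  nbcount (q * (K * g) + r) u v (fun s => light K (v :: s)) <=
  (b ^ (K * g) - 1) ^ q * b ^ r.
Proof.
move=> regG cycG; elim: q u v => [|q IH] u v auv.
  by rewrite mul1n -(nbcount_total r regG auv); apply: leq_nbcount.
have [s0 [sz0 nb0 cnt0]] := exists_loops K u (cycG v).
rewrite mulSn -addnA -sz0 expnS -mulnA.
apply: (nbcount_prefix_avoid regG auv nb0).
  move=> s; apply/negP => /forallP /(_ v).
  apply/negP; rewrite -ltnNge /= eqxx count_cat add1n ltnS.
  exact: leq_trans cnt0 (leq_addr _ _).
move=> s _ nbs; apply: leq_trans; last first.
  rewrite sz0; apply: IH (last u (belast v s)) (last v s) _.
  elim: s u v auv nbs {s0 sz0 nb0 cnt0} => // x s IHs u v auv /and3P[avx _ nbs].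
  exact: IHs nbs.
rewrite sz0; apply: leq_nbcount => s' /forallP h; apply/forallP => x.
apply: leq_trans (h x); rewrite -cat_cons (lastI v s) cat_rcons count_cat.
exact: leq_addl.
Qed.

(** Identifies walks as functions on 'I_m.+1 with lists of visited vertices. *)
Lemma card_nbwalks (G : sgraph) (m : nat) (w0 : G) (P : pred (seq G)) :
  #|[set w in nbwalks m w0 | P (codom w)]%SET| =
  nbcount m w0 w0 (fun s => P (w0 :: s)).
Proof.
pose f (t : m.-tuple G) : {ffun 'I_m.+1 -> G} :=
  [ffun i => tnth [tuple of w0 :: t] i].
have fcod t : codom (f t) = w0 :: t.
  rewrite -[RHS]/(tval [tuple of w0 :: t]) -[in RHS]map_tnth_enum codomE.
  by apply: eq_map => i; rewrite ffunE.
have fnth t i : f t i = nth w0 (w0 :: t) i.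
  by rewrite ffunE (tnth_nth w0).
have finj : injective f.
  by move=> s t st; apply: val_inj; have := fcod s; rewrite st fcod => -[].
rewrite /nbcount -(card_imset _ finj); apply: eq_card => w; rewrite inE.
have fnb t : f t \in nbwalks m w0 = nbpath w0 w0 t.
  rewrite inE; apply/and3P/nbpathP => [[_ /forallP ha /forallP hb] i|h].
    rewrite size_tuple => lti.
    have := ha (widen_ord (leqnSn m) (Ordinal lti)).
    move/forallP/(_ (lift ord0 (Ordinal lti))).
    rewrite /= eqxx !fnth /= => adji.
    split; first exact: adji.
    case: i lti adji => [|i] lti adji /=.
      by apply: contraTneq adji => ->; rewrite adj_irr.
    have lti' : i < m.+1 by rewrite ltnW // ltnW.
    have := hb (Ordinal lti') => /forallP /(_ (lift ord0 (Ordinal lti))).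
    by rewrite /= eqxx !fnth /= eq_sym.
  split.
  - by rewrite fnth.
  - apply/forallP => s; apply/forallP => t'; apply/implyP => /eqP st.
    rewrite !fnth st /=; apply: (h s _).1.
    by rewrite size_tuple -ltnS -st.
  - apply/forallP => s; apply/forallP => t'; apply/implyP => /eqP st.
    rewrite !fnth st /= eq_sym; apply: (h s.+1 _).2.
    by rewrite size_tuple -ltnS -st.
apply/andP/imsetP => [[nbw Pw] | [t]]; last first.
  by rewrite inE => /andP[nbt Pt] ->; rewrite fcod fnb.
have [t wt] : exists t, w = f t.
  exists [tuple w (lift ord0 i) | i < m]; apply/ffunP => i; rewrite ffunE.
  case: (unliftP ord0 i) => [j|] ->.
    rewrite (tnth_nth w0) /=.
    by rewrite -[nth _ _ j]/(nth w0 [tuple w (lift ord0 i) | i < m] j)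
      -tnth_nth tnth_mktuple.
  by rewrite (tnth_nth w0) /=; move: nbw; rewrite inE => /and3P[/eqP].
by exists t => //; rewrite inE -fnb -fcod -wt nbw Pw.
Qed.

Lemma visitsE (G : sgraph) (m : nat) (w : {ffun 'I_m.+1 -> G}) (v : G) :
  visits w v = count_mem v (codom w).
Proof.
rewrite /visits codomE count_map enumT cardE [in LHS]/enum_mem.
rewrite size_filter; apply: eq_count.
by move=> i; rewrite /= inE.
Qed.
End Continuations.

(** * The failure probability of all blocks *)

(** The first step of a walk has d choices instead of d - 1. *)
Lemma nbcount_start (G : sgraph) (m : nat) (w0 : G) (P : pred (seq G)) :
  nbcount m.+1 w0 w0 P =
  (\sum_(x | adj w0 x) nbcount m w0 x (fun s => P (x :: s)))%N.
Proof.
rewrite nbcountS; apply: eq_bigl => x; case: (eqVneq x w0) => [->|_].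
  by rewrite adj_irr.
by rewrite andbT.
Qed.

Lemma card_all_nbwalks (G : sgraph) (b m : nat) (w0 : G) :
  regular b.+1 G -> #|nbwalks m.+1 w0| = (b.+1 * b ^ m)%N.
Proof.
move=> regG; have := card_nbwalks m.+1 w0 xpredT; set A := finset _.
have -> : A = nbwalks m.+1 w0 by apply/setP => w; rewrite inE andbT.
move=> ->; rewrite nbcount_start -(regG w0) -sum_nat_const.
by apply: eq_bigr => x adjx; rewrite (nbcount_total m regG adjx).
Qed.

Lemma card_light_nbwalks (G : sgraph) (b g K q r : nat) (w0 : G) :
  regular b.+1 G -> (forall x : G, on_cycle g x) ->
  (#|[set w in nbwalks (q * (K * g) + r).+1 w0 | light K (codom w)]%SET| <=
   b.+1 * ((b ^ (K * g) - 1) ^ q * b ^ r))%N.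
Proof.
move=> regG cycG.
rewrite card_nbwalks nbcount_start -(regG w0) -sum_nat_const.
apply: leq_sum => x adjx; apply: leq_trans (nbcount_light K q r regG cycG adjx).
apply: leq_nbcount => s /forallP h; apply/forallP => y; apply: leq_trans (h y).
exact: leq_addl.
Qed.

Lemma nbw_prob_le1 (R : realType) (G : sgraph) (m : nat) (w0 : G)
    (E : pred {ffun 'I_m.+1 -> G}) : nbw_prob R w0 E <= 1.
Proof.
rewrite /nbw_prob; have [->|N0] := eqVneq #|nbwalks m w0| 0%N.
  by rewrite invr0 mulr0.
rewrite ler_pdivrMr ?ltr0n ?lt0n // mul1r ler_nat.
by apply/subset_leq_card/fintype.subsetP => w; rewrite inE => /andP[].
Qed.

Lemma nbw_prob_compl (R : realType) (G : sgraph) (m : nat) (w0 : G)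
    (E : pred {ffun 'I_m.+1 -> G}) :
  (0 < #|nbwalks m w0|)%N ->
  nbw_prob R w0 E + nbw_prob R w0 (predC E) = 1.
Proof.
move=> N0; rewrite /nbw_prob -mulrDl -natrD.
have -> : (#|[set w in nbwalks m w0 | E w]%SET| +
           #|[set w in nbwalks m w0 | predC E w]%SET|)%N = #|nbwalks m w0|.
  rewrite -(cardsID [set w | E w]%SET (nbwalks m w0)); congr (_ + _)%N.
    by apply: eq_card => w; rewrite !inE.
  by apply: eq_card => w; rewrite !inE andbC.
by rewrite divff // pnatr_eq0 -lt0n.
Qed.

(** For K = 0 the blocks are empty and the bound is 0 ^+ q; with q = 1 it says
    that the walk certainly visits some vertex at least k times. *)
Lemma nbw_prob_blocks (R : realType) (G : sgraph) (b g K q r m : nat) (k : R)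
    (w0 : G) :
  (0 < b)%N -> regular b.+1 G -> (forall x : G, on_cycle g x) ->
  k <= K.+1%:R -> m = (q * (K * g) + r).+1 ->
  1 - nbw_prob R w0 (@heavily_visited R G m k) <=
  (1 - (b%:R ^+ (K * g))^-1) ^+ q.
Proof.
move=> b0 regG cycG kK ->; set m' := (q * (K * g) + r)%N.
have cardN := card_all_nbwalks m' w0 regG.
have N0 : (0 < #|nbwalks m'.+1 w0|)%N by rewrite cardN muln_gt0 expn_gt0 b0.
have /eqP := nbw_prob_compl R (@heavily_visited R G m'.+1 k) N0.
rewrite addrC eq_sym -subr_eq => /eqP ->.
have bL0 : (b%:R : R) ^+ (K * g) != 0 by rewrite expf_neq0 // pnatr_eq0 -lt0n.
rewrite /nbw_prob ler_pdivrMr ?ltr0n // cardN.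
have -> : (1 - (b%:R ^+ (K * g))^-1) ^+ q * (b.+1 * b ^ m')%:R =
    (b.+1 * ((b ^ (K * g) - 1) ^ q * b ^ r))%:R :> R.
  rewrite /m'; set L := (K * g)%N in bL0 *.
  rewrite expnD expnM !natrM !natrX natrB ?expn_gt0 ?b0 // natrX.
  rewrite mulrCA; congr (_ * _); rewrite exprAC.
  rewrite mulrA -exprMn.
  by congr (_ ^+ _ * _); rewrite mulrBl mul1r mulVf.
rewrite ler_nat; apply: leq_trans (card_light_nbwalks K q r w0 regG cycG).
apply/subset_leq_card/fintype.subsetP => w; rewrite !inE => /andP[-> /=].
rewrite negb_exists => /forallP h; apply/forallP => v.
have := h v; rewrite -ltNge visitsE => lt.
by rewrite -ltnS -(ltr_nat R); exact: lt_le_trans lt kK.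
Qed.

Lemma expr1B_le (R : realType) (x : R) (q : nat) :
  0 <= x <= 1 -> (1 - x) ^+ q <= expR (- (q%:R * x)).
Proof.
move=> /andP[x0 x1]; rewrite -mulrN expRM_natl.
rewrite lerXn2r ?nnegrE ?subr_ge0 ?expR_ge0 //.
exact: expR_ge1Dx.
Qed.

Lemma exists_strict_ceil (R : realType) (x : R) :
  0 < x -> exists K : nat, K%:R < x <= K.+1%:R.
Proof.
move=> x0; have := ceil_itv x; have := ceil_gt0 x; rewrite x0.
case: (Num.ceil x) => [[|K]|] // _.
have -> : Posz K.+1 - 1 = K by rewrite -addn1 PoszD addrK.
by exists K.
Qed.

(** For k > 1, rounding k to K loses nothing: a block has K * g <= k * g steps
    although it gives K + 1 >= k visits. *)
Lemma nbw_prob_lower (R : realType) (G : sgraph) (b g : nat) (k : R) (w0 : G) :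
  let n := #|G| in
  let c := ln (b%:R : R) in
  let X := logb b%:R (n%:R / ln n%:R) - k * g%:R in
  (1 < b)%N -> regular b.+1 G -> (forall x : G, on_cycle g x) ->
  1 <= ln (n%:R : R) -> 0 <= X ->
  1 - expR (- (c * (1 + c * X) / 2)) <=
  nbw_prob R w0 (@heavily_visited R G n k).
Proof.
move=> n c X b1 regG cycG lnn X0.
have b0 : (0 < b)%N by exact: ltnW.
have n0 : (0 < n)%N by apply/card_gt0P; exists w0.
have g2 : (2 < g)%N by have [? []] := cycG w0.
have c0 : 0 < c by rewrite ln_gt0 // ltr1n.
rewrite lerBlDr -lerBlDl.
have [k1|k1] := leP k 1.
  (* The starting vertex alone suffices: one empty block (K = 0, q = 1). *)
  apply: le_trans (expR_ge0 _).
  have := @nbw_prob_blocks R G b g 0 1 n.-1 n k w0 b0 regG cycG k1.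
  by rewrite mul0n expr0 invr1 subrr expr1; apply; rewrite add0n prednK.
have [K /andP[Kk kK]] := exists_strict_ceil (lt_trans ltr01 k1).
pose L := (K * g)%N; pose q := (n.-1 %/ L)%N; pose r := (n.-1 %% L)%N.
have K0 : (0 < K)%N by rewrite -ltnS -(ltr_nat R); exact: lt_le_trans k1 kK.
have L0 : (0 < L)%N by rewrite muln_gt0 K0 (ltn_trans _ g2).
have nR : 0 < (n%:R : R) by rewrite ltr0n.
have ln0 : 0 < ln (n%:R : R) by exact: lt_le_trans lnn.
have nln : 0 < n%:R / ln n%:R :> R by exact: divr_gt0.
have LcE : L%:R * c <= ln (n%:R / ln n%:R) - c * X.
  have -> : ln (n%:R / ln n%:R) - c * X = k * g%:R * c.
    rewrite /X /logb -/c mulrBr mulrCA divff ?gt_eqF // mulr1.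
    by rewrite opprB addrCA subrr addr0 mulrC.
  by rewrite ler_pM2r // natrM ler_wpM2r // ltW.
have Lc : L%:R * c <= ln n%:R.
  apply: le_trans LcE _; rewrite lerBlDr.
  rewrite ler_wpDr ?mulr_ge0 ?(ltW c0) // ler_ln ?posrE //.
  by rewrite ler_pdivrMr // ler_peMr // ltW.
have bLE : (b%:R : R) ^+ L = expR (L%:R * c).
  by rewrite expRM_natl lnK // posrE ltr0n.
have bLX : (b%:R : R) ^+ L <= n%:R / ln n%:R * expR (- (c * X)).
  by rewrite bLE -[n%:R / ln n%:R]lnK ?posrE // -expRD ler_expR.
(* At least one block fits into the walk, because L < b ^ L <= n. *)
have Ln : (L < n)%N.
  apply: (leq_trans (ltn_expl L b1)); rewrite -(ler_nat R) natrX bLE.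
  by rewrite -[leRHS]lnK ?posrE // ler_expR.
(* Rounding down (n - 1) / L >= 1 costs at most a factor 2. *)
have nq : (n <= 2 * q * L)%N.
  have : (0 < q)%N by rewrite divn_gt0 // -ltnS prednK.
  have := divn_eq n.-1 L; have := ltn_pmod n.-1 L0.
  rewrite -/q -/r; nia.
have bL0 : 0 < (b%:R : R) ^+ L by rewrite bLE expR_gt0.
have p01 : 0 <= ((b%:R : R) ^+ L)^-1 <= 1.
  by rewrite invr_ge0 (ltW bL0) invf_le1 // exprn_ege1 // ler1n.
apply: le_trans (@nbw_prob_blocks R G b g K q r n k w0 b0 regG cycG kK _) _.
  by rewrite -divn_eq prednK.
apply: le_trans (expr1B_le q p01) _; rewrite ler_expR lerN2.
rewrite -/L ler_pdivrMr // mulrAC -natrM [(q * 2)%N]mulnC.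
rewrite -(ler_pM2r (_ : 0 < L%:R)) ?ltr0n //.
apply: (@le_trans _ _ (ln n%:R * expR (c * X))).
  rewrite mulrAC [c * L%:R]mulrC ler_pM ?expR_ge1Dx // ?addr_ge0 //.
  by rewrite mulr_ge0 // ltW.
  by rewrite mulr_ge0 // ltW.
apply: (@le_trans _ _ (((b%:R : R) ^+ L)^-1 * n%:R)).
  rewrite -[leRHS]mulrC ler_pdivlMr //.
  have nE : n%:R / ln n%:R * expR (- (c * X)) * (ln n%:R * expR (c * X)) =
      n%:R :> R.
    by rewrite mulrACA divfK ?gt_eqF // -expRD addNr expR0 mulr1.
  by rewrite -[leRHS]nE mulrC ler_wpM2r // mulr_ge0 ?expR_ge0 // ltW.
rewrite [(2 * q)%:R * _]mulrC -mulrA ler_wpM2l ?invr_ge0 ?(ltW bL0) //.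
by rewrite -natrM ler_nat.
Qed.

(** * Passing to the limit *)

Lemma cvgy_ln (R : realType) (n : nat -> nat) :
  n i @[i --> \oo] --> \oo -> ln ((n i)%:R : R) @[i --> \oo] --> +oo.
Proof.
move=> /cvgnyPge ncvg; apply/cvgryPge => A.
near=> i.
have eA : expR A <= (n i)%:R.
  apply: (@le_trans _ _ (Num.trunc (expR A)).+1%:R).
    by rewrite ltW // -truncn_lt_nat ?expR_ge0.
  by rewrite ler_nat; near: i; exact: ncvg.
by rewrite -[A]expRK ler_ln // posrE ?expR_gt0 // (lt_le_trans _ eA) ?expR_gt0.
Unshelve. all: by end_near. Qed.

Lemma nbw_prob_cvg1 (R : realType) (b : nat) (G : nat -> sgraph)
    (g : nat -> nat) (k : nat -> R) (w0 : forall i, G i) :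
  (1 < b)%N -> regular_seq_with_cycles b.+1 G g ->
  logb b%:R (#|G i|%:R / ln #|G i|%:R) - k i * (g i)%:R
    @[i --> \oo] --> +oo ->
  nbw_prob R (w0 i) (@heavily_visited R (G i) #|G i| (k i))
    @[i --> \oo] --> (1 : R).
Proof.
move=> b1 [ncvg regG cycG] Xcvg.
set c := ln (b%:R : R); have c0 : 0 < c by rewrite ln_gt0 // ltr1n.
pose X i := logb b%:R (#|G i|%:R / ln #|G i|%:R) - k i * (g i)%:R.
apply: (@squeeze_cvgr _ _ _ _
  (fun i => 1 - expR (- (c * (1 + c * X i) / 2))) (fun=> 1)).
- near=> i; rewrite nbw_prob_le1 andbT.
  apply: nbw_prob_lower => //.
    near: i; have /cvgryPge := @cvgy_ln R _ ncvg; exact.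
  by near: i; have /cvgryPge := Xcvg; exact.
- rewrite -[X in _ --> X]subr0; apply: cvgB; first exact: cvg_cst.
  apply: (cvg_comp _ _ _ (@cvgr_expR R)).
  apply/cvgryPge => A; near=> i.
  have : 2 * A / c / c <= X i by near: i; have /cvgryPge := Xcvg; exact.
  rewrite !ler_pdivrMr // ler_pdivlMr // => h.
  have : 0 < c * c by exact: mulr_gt0.
  nra.
- exact: cvg_cst.
Unshelve. all: by end_near. Qed.

(** With y = ln n the gap is (y / 2 - ln y) / ln b, and ln y is at most
    y / 4 + 3. *)
Lemma cvgy_half_log_gap (R : realType) (b : nat) (n : nat -> nat) :
  (1 < b)%N -> n i @[i --> \oo] --> \oo ->
  logb b%:R ((n i)%:R / ln (n i)%:R) - (2 * ln b%:R)^-1 * ln (n i)%:R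
    @[i --> \oo] --> (+oo : set_system R).
Proof.
move=> b1 ncvg; set c := ln (b%:R : R).
have c0 : 0 < c by rewrite ln_gt0 // ltr1n.
have /cvgryPge lncvg := @cvgy_ln R _ ncvg.
apply/cvgryPge => A; near=> i.
have y1 : 1 <= ln ((n i)%:R : R) by near: i; exact: lncvg.
have yA : 4 * (A * c + 3) <= ln ((n i)%:R : R) by near: i; exact: lncvg.
set y := ln ((n i)%:R : R) in y1 yA *.
have y0 : 0 < y by exact: lt_le_trans y1.
have n0 : 0 < ((n i)%:R : R).
  rewrite lt_neqAle ler0n andbT.
  by apply: contraTneq y0 => n0; rewrite /y -n0 ln0 // ltxx.
have lny : ln y <= y / 4 + 3.
  (* ln y = ln (y / 4) + ln 4, each term bounded by ln (1 + t) <= t. *)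
  have -> : y = (1 + (y / 4 - 1)) * (1 + 3) by lra.
  have y40 : 0 < 1 + (y / 4 - 1) by lra.
  rewrite lnM ?posrE //; have := @le_ln1Dx R (y / 4 - 1); have := @le_ln1Dx R 3.
  lra.
rewrite /logb -/c ln_div ?posrE // -/y invfM mulrAC -mulrBl ler_pdivlMr //.
lra.
Unshelve. all: by end_near. Qed.

Theorem claim3p3 (R : realType) (d : nat) (hd : (3 <= d)%N) :
  (forall (G : nat -> sgraph) (g : nat -> nat),
     regular_seq_with_cycles d G g ->
     forall k : nat -> R,
       logb (d%:R - 1) (#|G i|%:R / ln #|G i|%:R) - k i * (g i)%:R
         @[i --> \oo] --> +oo ->
     forall w0 : (forall i, G i),
       nbw_prob R (w0 i) (@heavily_visited R (G i) #|G i| (k i))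
         @[i --> \oo] --> (1 : R))
  /\
  (exists2 c : R, 0 < c &
     forall (G : nat -> sgraph) (g : nat -> nat),
       regular_seq_with_cycles d G g ->
     forall w0 : (forall i, G i),
       nbw_prob R (w0 i)
         (@heavily_visited R (G i) #|G i| (c * (ln #|G i|%:R / (g i)%:R)))
         @[i --> \oo] --> (1 : R)).
Proof.
case: d hd => // b; rewrite ltnS => b1.
split=> [G g seqG k|].
  have -> : b.+1%:R - 1 = b%:R :> R by rewrite -natr1 addrK.
  by move=> Xcvg w0; exact: (nbw_prob_cvg1 w0 b1 seqG Xcvg).
have c0 : 0 < ln (b%:R : R) by rewrite ln_gt0 // ltr1n.
exists (2 * ln b%:R)^-1; first by rewrite invr_gt0 mulr_gt0.
move=> G g seqG w0; apply: (nbw_prob_cvg1 _ b1 seqG).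
have [ncvg _ cycG] := seqG.
have kg : forall i, (2 * ln b%:R)^-1 * (ln #|G i|%:R / (g i)%:R) * (g i)%:R =
    (2 * ln b%:R)^-1 * ln #|G i|%:R :> R.
  move=> i; have [? [g2 _ _ _]] := cycG i (w0 i).
  by rewrite mulrA divfK // pnatr_eq0; case: (g i) g2.
under eq_fun do rewrite kg.
exact: cvgy_half_log_gap.
Qed.
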